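(* Let $A,B,C\in\mathbb{M}_n$. Then there exist four isometries $U_1,U_2,U_3,U_4\in\mathbb{M}_{4n,n}$ such that $$|A+B+C|^2\oplus|A|^2\oplus|B|^2\oplus|C|^2=\frac14\sum_{k=1}^4U_k\left(|A+B|^2+|B+C|^2+|A+C|^2\right)U_k^*.$$
   Context: $\mathbb{M}_{m,n}$ is the space of $m\times n$ complex matrices, $\mathbb{M}_n=\mathbb{M}_{n,n}$; $|Z|^2=Z^*Z$. $\oplus$ denotes the block-diagonal direct sum. An isometry in $\mathbb{M}_{4n,n}$ is a matrix $V$ with $V^*V=I_n$. *)

(* Defs.v *)
From mathcomp Require Import all_boot all_order all_algebra.
From mathcomp Require Import reals complex.

Set Implicit Arguments.
Unset Strict Implicit.
Unset Printing Implicit Defensive.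

Import GRing.Theory Num.Theory.
Local Open Scope ring_scope.
Local Open Scope sesquilinear_scope.

(* |Z|^2 *)
Definition sqabsmx (C : numClosedFieldType) (m n : nat) (Z : 'M[C]_(m, n)) :
  'M[C]_n := Z ^t* *m Z.

(* The library's unitarymx asks for X *m X ^t* = 1, i.e. for orthonormal rows;
   an isometry has orthonormal columns. *)
Definition isometrymx (C : numClosedFieldType) (m n : nat) (V : 'M[C]_(m, n)) :
  Prop := V ^t* *m V = 1%:M.

Definition dsummx (C : numClosedFieldType) (m n : nat) (X : 'M[C]_m)
  (Y : 'M[C]_n) : 'M[C]_(m + n) := block_mx X 0 0 Y.

(* Main.v *)
(** If [Z] stacks [Z_1], ..., [Z_4] vertically and [S = \sum_i |Z_i|^2], then
    [Z^* Z = S], and [Z Z^* = V S V^*] for some isometry [V], because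
    [M M^*] and [M^* M] are unitarily equivalent (pad [Z] to a square matrix).
    Averaging [Z Z^*] over conjugations by the four sign patterns of a
    Hadamard matrix kills its off-diagonal blocks and leaves
    [\oplus_i Z_i Z_i^*], which is unitarily equivalent to
    [\oplus_i |Z_i|^2].  The theorem is the case of [A + B + C], [A], [B], [C],
    for which [S = |A + B|^2 + |B + C|^2 + |A + C|^2]. *)
Require Import Defs.
From mathcomp Require Import all_boot all_order all_fingroup all_algebra.
From mathcomp Require Import reals complex.

Set Implicit Arguments.
Unset Strict Implicit.
Unset Printing Implicit Defensive.

Import GRing.Theory Num.Theory.
Local Open Scope ring_scope.

(* The determinant of [['X, A], [B, 1]] is computed by eliminating either
   off-diagonal block. *)
Lemma char_poly_mulC (R : comNzRingType) n (A B : 'M[R]_n) :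
  char_poly (A *m B) = char_poly (B *m A).
Proof.
rewrite /char_poly /char_poly_mx !map_mxM /=.
set A' := map_mx _ A; set B' := map_mx _ B; set x : 'M_n := 'X%:M.
pose M := block_mx x A' B' 1%:M.
have detAB : \det M = \det (x - A' *m B').
  have := det_mulmx M (block_mx 1%:M 0 (- B') 1%:M).
  rewrite mulmx_block !(mulmx1, mul1mx, mulmx0, mulmxN, add0r, subrr).
  by rewrite det_ublock det_lblock !det1 !mulr1.
have detBA : \det x * \det M = \det x * \det (x - B' *m A').
  have := det_mulmx (block_mx 1%:M 0 (- B') x) M.
  rewrite mulmx_block !(mulmx1, mul1mx, mul0mx, mulNmx, addr0).
  rewrite [- (B' *m x)]( _ : _ = - (x *m B')); last by rewrite scalar_mxC.
  by rewrite addNr det_ublock det_lblock det1 mul1r [- _ + _]addrC.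
(* [\det x] is a power of ['X]; being monic, it cancels even when [R] has zero divisors. *)
move: detBA; rewrite detAB det_scalar.
by apply: monic_lreg; apply: monicXn.
Qed.

Section UnitaryEquivalence.
Local Open Scope sesquilinear_scope.
Variable C : numClosedFieldType.

Lemma adjmxM m n p (A : 'M[C]_(m, n)) (B : 'M_(n, p)) :
  (A *m B)^t* = B^t* *m A^t*.
Proof. by rewrite trmx_mul map_mxM. Qed.

Lemma adj_col_mx m1 m2 p (X : 'M[C]_(m1, p)) (Y : 'M_(m2, p)) :
  (col_mx X Y)^t* = row_mx (X^t*) (Y^t*).
Proof. by rewrite tr_col_mx map_row_mx. Qed.

Lemma adj_signmxZ m p b (X : 'M[C]_(m, p)) :
  ((-1) ^+ b *: X)^t* = (-1) ^+ b *: (X^t*).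
Proof. by rewrite linearZ /= map_mxZ /= rmorph_sign. Qed.

Lemma perm_mx_unitary n (s : 'S_n) : perm_mx s \is @unitarymx C n n.
Proof.
by apply/unitarymxP; rewrite tr_perm_mx map_perm_mx -perm_mxM mulgV perm_mx1.
Qed.

Lemma diag_mx_perm_similar n (d e : 'rV[C]_n) :
  perm_eq [seq d 0 i | i : 'I_n] [seq e 0 i | i : 'I_n] ->
  exists s : 'S_n, diag_mx d = perm_mx s *m diag_mx e *m (perm_mx s)^t*.
Proof.
have tupleE (f : 'rV[C]_n) : [seq f 0 i | i : 'I_n] = [tuple f 0 i | i < n].
  by [].
rewrite tupleE [X in perm_eq _ X]tupleE => /tuple_permP [s /val_inj des].
exists s; rewrite tr_perm_mx map_perm_mx -row_permE -col_permE.
apply/matrixP=> i j; rewrite !mxE (inj_eq perm_inj).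
by have /(congr1 (fun t => tnth t i)) := des; rewrite !tnth_mktuple => ->.
Qed.

(** The spectral theorem diagonalizes both matrices unitarily. Equal characteristic polynomials give
    the same eigenvalues with multiplicity, so the two diagonal forms differ by a permutation
    matrix, itself unitary. *)
Lemma normalmx_char_poly_similar n (M N : 'M[C]_n) :
  M \is normalmx -> N \is normalmx -> char_poly M = char_poly N ->
  exists2 W, W \is unitarymx & M = W *m N *m W^t*.
Proof.
have unitspec (X : 'M[C]_n) : spectralmx X *m (spectralmx X)^t* = 1%:M.
  exact/unitarymxP/spectral_unitarymx.
have spec (X : 'M[C]_n) : X \is normalmx ->
    X = (spectralmx X)^t* *m diag_mx (spectral_diag X) *m spectralmx X.
  by move=> /orthomx_spectralP {1}->; rewrite invmx_unitary ?spectral_unitarymx.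
have char (X : 'M[C]_n) : X \is normalmx -> char_poly X =
    \prod_(x <- [seq spectral_diag X 0 i | i : 'I_n]) ('X - x%:P).
  move=> /spec {1}->; rewrite char_poly_mulC mulmxA unitspec mul1mx.
  rewrite char_poly_trig ?diag_mx_is_trig // big_image /=.
  by apply: eq_bigr => i _; rewrite mxE eqxx.
move=> Mn Nn; rewrite !char // => /prod_XsubC_eq/diag_mx_perm_similar[s deq].
exists ((spectralmx M)^t* *m perm_mx s *m spectralmx N).
  rewrite !mul_unitarymx ?trmxC_unitary ?spectral_unitarymx //.
  exact: perm_mx_unitary.
rewrite {1}(spec M Mn) deq {3}(spec N Nn) !adjmxM trmxCK !mulmxA.
by rewrite !(mulmxtVK _ (spectral_unitarymx N)).
Qed.

Lemma gram_normal m n (Z : 'M[C]_(m, n)) : sqabsmx Z \is normalmx.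
Proof. by apply/normalmxP; rewrite /sqabsmx adjmxM trmxCK. Qed.

Lemma gram_unitary_equiv n (Z : 'M[C]_n) :
  exists2 W, W \is unitarymx & sqabsmx Z = W *m sqabsmx (Z^t*) *m W^t*.
Proof.
apply: normalmx_char_poly_similar; rewrite ?gram_normal //.
by rewrite /sqabsmx trmxCK char_poly_mulC.
Qed.

(** Padding [Z] with [p] zero columns keeps [Z Z^*] and turns [Z^* Z] into a block matrix that is
    zero outside its first block. Only the first [n] columns of the unitary [W] then contribute. *)
Lemma gram_isometry_equiv n p (Z : 'M[C]_(n + p, n)) :
  exists2 V, isometrymx V & sqabsmx (Z^t*) = V *m sqabsmx Z *m V^t*.
Proof.
have [W Wu] := gram_unitary_equiv ((row_mx Z (0 : 'M_(n + p, p)))^t*).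
rewrite /sqabsmx trmxCK tr_row_mx map_col_mx trmx0 map_mx0 mul_row_col.
rewrite mul0mx addr0 mul_col_row mulmx0 mul0mx mul0mx -{1 2}[W]hsubmxK.
rewrite tr_row_mx map_col_mx mul_row_block mul_row_col !(mulmx0, mul0mx, addr0).
exists (lsubmx W); rewrite ?trmxCK //.
(* The upper left block of this identity says that [lsubmx W] is an isometry. *)
have : W^t* *m W = 1%:M by rewrite -invmx_unitary // mulVmx // unitarymx_unit.
rewrite -{1 2}[W]hsubmxK tr_row_mx map_col_mx mul_col_row scalar_mx_block.
by case/eq_block_mx.
Qed.

Section Pinching.
Variables (n : nat) (T1 T2 T3 T4 : 'M[C]_n).

(* The rows of signs (1, e, f, ef), for e, f = 1, -1, form a Hadamard matrix. *)
Definition pinch_mx (k : 'I_4) : 'M[C]_(n + (n + (n + n)), n) :=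
  let e := (-1) ^+ odd k in let f := (-1) ^+ (1 < k)%N in
  col_mx T1 (col_mx (e *: T2) (col_mx (f *: T3) ((e * f) *: T4))).

Lemma pinch_mx_isometry k :
  sqabsmx T1 + (sqabsmx T2 + (sqabsmx T3 + sqabsmx T4)) = 1%:M ->
  isometrymx (pinch_mx k).
Proof.
rewrite /isometrymx /pinch_mx -signr_addb !adj_col_mx !adj_signmxZ => <-.
rewrite !mul_row_col -!scalemxAl -!scalemxAr !scalerA -!expr2 !sqrr_sign.
by rewrite !scale1r.
Qed.

(** Block [(i, j)] of the sum carries the inner product of sign columns [i] and [j]: 4 on the
    diagonal and 0 off it, by orthogonality. *)
Lemma sum_pinch_mx (S : 'M[C]_n) :
  \sum_k (pinch_mx k *m S *m (pinch_mx k)^t*) =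
  4 *: dsummx (T1 *m S *m T1^t*) (dsummx (T2 *m S *m T2^t*)
    (dsummx (T3 *m S *m T3^t*) (T4 *m S *m T4^t*))).
Proof.
have adjN (X : 'M[C]_n) : (- X)^t* = - X^t* by rewrite linearN map_mxN.
rewrite !big_ord_recl big_ord0 addr0 /pinch_mx /dsummx /= !(expr0, expr1).
rewrite !(mulrNN, mulr1, mul1r, scale1r, scaleN1r).
rewrite !adj_col_mx !adjN !(mul_col_mx _ _ S) !mul_col_row.
rewrite !(mul_mx_row, mul_col_mx, mulmxN, mulNmx, opprK).
rewrite !(add_block_mx, add_row_mx, add_col_mx) !addrA.
rewrite !(subrr, add0r, addNr, addrK, row_mx0, col_mx0).
by rewrite !scale_block_mx !scaler0 !scaler_nat !mulrS !mulr0n !addr0 !addrA.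
Qed.

End Pinching.

Lemma direct_sum_gram_average n (Z1 Z2 Z3 Z4 : 'M[C]_n)
    (S := sqabsmx Z1 + (sqabsmx Z2 + (sqabsmx Z3 + sqabsmx Z4))) :
  exists U : 'I_4 -> 'M[C]_(n + (n + (n + n)), n),
    (forall k, isometrymx (U k)) /\
    dsummx (sqabsmx Z1)
      (dsummx (sqabsmx Z2) (dsummx (sqabsmx Z3) (sqabsmx Z4))) =
    4^-1 *: \sum_k (U k *m S *m (U k)^t*).
Proof.
pose Z := col_mx Z1 (col_mx Z2 (col_mx Z3 Z4)).
have ZS : sqabsmx Z = S by rewrite /sqabsmx !adj_col_mx !mul_row_col.
have [V] := gram_isometry_equiv Z; rewrite ZS /sqabsmx trmxCK.
rewrite -[V]vsubmxK -[dsubmx V]vsubmxK -[dsubmx (dsubmx V)]vsubmxK.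
set V1 := usubmx V; set V2 := usubmx _; set V3 := usubmx _; set V4 := dsubmx _.
rewrite /isometrymx !adj_col_mx !mul_row_col !(mul_col_mx _ _ S) !mul_col_row => Viso.
case/eq_block_mx => ZV1 _ _ /eq_block_mx[ZV2 _ _ /eq_block_mx[ZV3 _ _ ZV4]].
(* The diagonal blocks are [Z_i Z_i^*], not [|Z_i|^2]. A unitary factor absorbed into [V_i] makes
   the exchange and preserves [|V_i|^2], hence the isometry condition. *)
have turn (X Y : 'M[C]_n) : X *m X^t* = Y *m S *m Y^t* ->
    exists2 T, sqabsmx T = sqabsmx Y & sqabsmx X = T *m S *m T^t*.
  have [W Wu WX XY] := gram_unitary_equiv X; exists (W *m Y).
    by rewrite /sqabsmx adjmxM !mulmxA mulmxKtV.
  by rewrite WX /sqabsmx trmxCK XY adjmxM !mulmxA.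
have [T1 TV1 ZT1] := turn _ _ ZV1; have [T2 TV2 ZT2] := turn _ _ ZV2.
have [T3 TV3 ZT3] := turn _ _ ZV3; have [T4 TV4 ZT4] := turn _ _ ZV4.
exists (pinch_mx T1 T2 T3 T4); split=> [k|].
  by apply: pinch_mx_isometry; rewrite TV1 TV2 TV3 TV4.
rewrite sum_pinch_mx scalerA mulVf ?pnatr_eq0 // scale1r.
by rewrite -ZT1 -ZT2 -ZT3 -ZT4.
Qed.

(** On expansion, either side has each square twice and each of the six cross terms once. *)
Lemma sqabsmx_sum3 m n (X Y Z : 'M[C]_(m, n)) :
  sqabsmx (X + Y + Z) + (sqabsmx X + (sqabsmx Y + sqabsmx Z)) =
  sqabsmx (X + Y) + sqabsmx (Y + Z) + sqabsmx (X + Z).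
Proof.
have adjD (U V : 'M[C]_(m, n)) : (U + V)^t* = U^t* + V^t*.
  by rewrite linearD map_mxD.
rewrite /sqabsmx !adjD !mulmxDl !mulmxDr !addrA.
by rewrite [LHS](ACl (1*2*4*5*11*6*8*9*10*3*7*12)).
Qed.

End UnitaryEquivalence.

Theorem theorem1p39 (R : realType) (n : nat) (A B C : 'M[R[i]]_n) :
  exists U : 'I_4 -> 'M[R[i]]_(n + (n + (n + n)), n),
    (forall k : 'I_4, isometrymx (U k)) /\
    dsummx (sqabsmx (A + B + C))
      (dsummx (sqabsmx A) (dsummx (sqabsmx B) (sqabsmx C))) =
    4^-1 *: \sum_(k < 4)
      (U k *m (sqabsmx (A + B) + sqabsmx (B + C) + sqabsmx (A + C))
         *m (U k) ^t*%sesqui).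
Proof.
have [U [Uiso UE]] := direct_sum_gram_average (A + B + C) A B C.
exists U; split; first exact: Uiso.
rewrite -sqabsmx_sum3.
exact: UE.
Qed.
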